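(* The class of normal balleans is $\lambda$-stable.
   Context: A coarse structure on a set $X$ is a family $\mathcal{E}$ of subsets of $X\times X$ such that: each $E\in\mathcal{E}$ contains the diagonal $\triangle_X=\{(x,x):x\in X\}$; if $E,E'\in\mathcal{E}$ then $E\circ E'\in\mathcal{E}$ and $E^{-1}\in\mathcal{E}$, where $E\circ E'=\{(x,y):\exists z\,((x,z)\in E,\ (z,y)\in E')\}$ and $E^{-1}=\{(y,x):(x,y)\in E\}$; if $E\in\mathcal{E}$ and $\triangle_X\subseteq E'\subseteq E$ then $E'\in\mathcal{E}$; and $\bigcup\mathcal{E}=X\times X$. The pair $(X,\mathcal{E})$ is called a ballean (or coarse space). For $E\in\mathcal{E}$, $x\in X$, $A\subseteq X$: $E[x]=\{y\in X:(x,y)\in E\}$ and $E[A]=\bigcup_{a\in A}E[a]$. A subset $B\subseteq X$ is bounded if $B\subseteq E[x]$ for some $E\in\mathcal{E}$, $x\in X$; otherwise it is unbounded. Subsets $A,B$ of $X$ are close if there is $E\in\mathcal{E}$ with $A\subseteq E[B]$ and $B\subseteq E[A]$. They are linked, written $A\,\lambda_{(X,\mathcal{E})}\,B$, if either both $A,B$ are bounded or there exist unbounded subsets $A'\subseteq A$, $B'\subseteq B$ that are close. Balleans $(X,\mathcal{E})$, $(X,\mathcal{E}')$ on the same set are $\lambda$-equivalent if $\lambda_{(X,\mathcal{E})}=\lambda_{(X,\mathcal{E}')}$. A class $\mathcal{K}$ of balleans is $\lambda$-stable if for any two $\lambda$-equivalent balleans $(X,\mathcal{E})$, $(X,\mathcal{E}')$,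 $(X,\mathcal{E})\in\mathcal{K}$ implies $(X,\mathcal{E}')\in\mathcal{K}$. Subsets $A,B$ of $X$ are asymptotically disjoint if $E[A]\cap E[B]$ is bounded for every $E\in\mathcal{E}$. A subset $U\subseteq X$ is an asymptotic neighbourhood of $A\subseteq X$ if $E[A]\setminus U$ is bounded for every $E\in\mathcal{E}$. A ballean is normal if any two asymptotically disjoint subsets have disjoint asymptotic neighbourhoods. *)

(* Defs.v *)
(* MathComp world, with the sets and relations of mathcomp.classical. *)
From mathcomp Require Import all_boot.
From mathcomp Require Import boolp classical_sets.

Set Implicit Arguments.
Unset Strict Implicit.
Unset Printing Implicit Defensive.

Local Open Scope classical_set_scope.
Local Open Scope relation_scope.

(* The library's [E' \; E] is the set of pairs [(x, y)] for which some [z] has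
   [(x, z)] in [E] and [(z, y)] in [E']: it is the composition E o E' (the
   relation E is followed first). *)
Record coarse_structure (X : Type) := CoarseStructure {
  entourage_of : set (set (X * X)) ;
  coarse_diagonal : forall E, entourage_of E -> diagonal `<=` E ;
  coarse_comp : forall E E',
    entourage_of E -> entourage_of E' -> entourage_of (E' \; E) ;
  coarse_inv : forall E, entourage_of E -> entourage_of E^-1 ;
  coarse_sub : forall E E',
    entourage_of E -> diagonal `<=` E' -> E' `<=` E -> entourage_of E' ;
  coarse_cover : \bigcup_(E in entourage_of) E = [set: X * X] }.

Definition ball (X : Type) (E : set (X * X)) (x : X) : set X :=
  [set y | E (x, y)].

Definition set_ball (X : Type) (E : set (X * X)) (A : set X) : set X :=
  \bigcup_(a in A) ball E a.

Section Balleans.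
Context (X : Type) (C : coarse_structure X).
Implicit Types A B U V : set X.

Definition bounded B := exists E x, entourage_of C E /\ B `<=` ball E x.

Definition close A B :=
  exists E, [/\ entourage_of C E, A `<=` set_ball E B & B `<=` set_ball E A].

Definition linked A B :=
  (bounded A /\ bounded B) \/
  exists A' B', [/\ A' `<=` A, B' `<=` B, ~ bounded A', ~ bounded B' &
                    close A' B'].

Definition asymptotically_disjoint A B :=
  forall E, entourage_of C E -> bounded (set_ball E A `&` set_ball E B).

Definition asymptotic_neighbourhood A U :=
  forall E, entourage_of C E -> bounded (set_ball E A `\` U).

Definition normal_ballean :=
  forall A B, asymptotically_disjoint A B ->
    exists U V, [/\ asymptotic_neighbourhood A U,
                    asymptotic_neighbourhood B V & U `&` V = set0].

End Balleans.

Definition lambda_equivalent (X : Type) (C C' : coarse_structure X) :=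
  linked C = linked C'.

(* A class of balleans is a predicate on pairs (X, C), with X ranging over all
   types; no isomorphism invariance is required of it. *)
Definition lambda_stable (K : forall X : Type, coarse_structure X -> Prop) :=
  forall (X : Type) (C C' : coarse_structure X),
    lambda_equivalent C C' -> K X C -> K X C'.

(* Main.v *)
From mathcomp Require Import all_boot.
From mathcomp Require Import boolp classical_sets.
Require Import Defs.

(** Two sets are asymptotically disjoint iff they have no close unbounded
    subsets, and [U] is an asymptotic neighbourhood of [A] iff [A] and the
    complement of [U] are asymptotically disjoint. As the relation [linked]
    determines the bounded sets (those linked to the empty set), it determines
    asymptotic disjointness, hence asymptotic neighbourhoods and normality. *)

Set Implicit Arguments.
Unset Strict Implicit.
Unset Printing Implicit Defensive.

Local Open Scope classical_set_scope.
Local Open Scope relation_scope.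

Section Ballean.
Context (X : Type) (C : coarse_structure X).
Implicit Types (A B U : set X) (E : set (X * X)).

Lemma set_ballS E A B : A `<=` B -> set_ball E A `<=` set_ball E B.
Proof. by move=> sAB x [a /sAB Ba Eax]; exists a. Qed.

Lemma boundedS A B : A `<=` B -> bounded C B -> bounded C A.
Proof. by move=> sAB [E [x [CE sB]]]; exists E, x; split=> // y /sAB/sB. Qed.

Lemma bounded0 (x : X) : bounded C set0.
Proof.
have [E CE _] : (\bigcup_(E in entourage_of C) E) (x, x).
  by rewrite coarse_cover.
by exists E, x; split=> // y [].
Qed.

Lemma bounded_set_ball E B :
  entourage_of C E -> bounded C B -> bounded C (set_ball E B).
Proof.
move=> CE [F [x [CF sB]]]; exists (E \; F), x; split; first exact: coarse_comp.
by move=> y [b /sB Fxb Eby]; exists b.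
Qed.

Lemma asymptotically_disjointP A B :
  asymptotically_disjoint C A B <->
  ~ exists A' B', [/\ A' `<=` A, B' `<=` B, ~ bounded C A', ~ bounded C B' &
                      close C A' B'].
Proof.
split=> [disAB [A' [B' [sA sB nA _ [E [CE sAE _]]]]]|ncl E CE].
  (* [A'] lies in [set_ball E A] by the diagonal and in [set_ball E B] by closeness. *)
  apply: nA; apply: boundedS (disAB E CE) => x A'x; split.
    by exists x; [exact: sA | apply: (coarse_diagonal CE)].
  exact: (set_ballS sB (sAE _ A'x)).
apply: contrapT => nD; apply: ncl.
set D := set_ball E A `&` set_ball E B in nD.
have CV : entourage_of C (E^-1 \; E) by apply: coarse_comp => //; apply: coarse_inv.
(* These are the points of [A] and of [B] from which [E] reaches [D]. The [E]-ball of each covers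
   [D], so neither is bounded; passing through [D] makes them close. *)
exists (A `&` set_ball E^-1 D), (B `&` set_ball E^-1 D); split.
- by move=> x [].
- by move=> x [].
- move=> bA; apply: nD; apply: boundedS (bounded_set_ball CE bA).
  move=> d Dd; have [[a Aa Ead] _] := Dd.
  by exists a => //; split=> //; exists d.
- move=> bB; apply: nD; apply: boundedS (bounded_set_ball CE bB).
  move=> d Dd; have [_ [b Bb Ebd]] := Dd.
  by exists b => //; split=> //; exists d.
- exists (E^-1 \; E); split=> // x [_ [d Dd Exd]].
    have [_ [b Bb Ebd]] := Dd.
    by exists b; [split=> //; exists d | exists d].
  have [[a Aa Ead] _] := Dd.
  by exists a; [split=> //; exists d | exists d].
Qed.

(** Bounded sets are always linked, so disjointness is not the negation of [linked]; the implication
    excludes only links through unbounded subsets. *)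
Lemma asymptotically_disjoint_linked A B :
  asymptotically_disjoint C A B <->
  (linked C A B -> bounded C A /\ bounded C B).
Proof.
rewrite asymptotically_disjointP; split=> [ncl [//|/ncl //]|lb clAB].
have [bA _] : bounded C A /\ bounded C B by apply: lb; right.
by case: clAB => A' [B' [sA _ nA _ _]]; apply/nA/(boundedS sA).
Qed.

Lemma asymptotic_neighbourhoodP A U :
  asymptotic_neighbourhood C A U <-> asymptotically_disjoint C A (~` U).
Proof.
split=> nbh E CE; last first.
  apply: boundedS (nbh E CE) => x [EAx nUx]; split=> //.
  by exists x => //; apply: (coarse_diagonal CE).
have CV : entourage_of C (E^-1 \; E) by apply: coarse_comp => //; apply: coarse_inv.
(* [E] leads from both [a] and [z] to [y], so [z] lies outside [U] but in the [E^-1 \; E]-ball of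
   [A]. *)
apply: boundedS (bounded_set_ball CE (nbh _ CV)) => y [[a Aa Eay] [z nUz Ezy]].
by exists z => //; split=> //; exists a => //; exists y.
Qed.

Lemma bounded_linked0 (x : X) B : bounded C B <-> linked C B set0.
Proof.
split=> [bB|[[]//|[_ [B' [_ sB _ nB _]]]]].
  by left; split=> //; exact: bounded0 x.
by case: nB; apply: boundedS sB (bounded0 x).
Qed.

End Ballean.

(* On an empty type no set is bounded, not even [set0], since [bounded] asks for
   a centre; [linked] then no longer detects boundedness. *)
Lemma normal_ballean_empty (X : Type) (C : coarse_structure X) :
  (X -> False) -> normal_ballean C.
Proof.
move=> X0 A B disAB; exists set0, set0; split; last exact: setI0.
- by move=> E /disAB[_ [x _]]; case: (X0 x).
- by move=> E /disAB[_ [x _]]; case: (X0 x).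
Qed.

Lemma lambda_equivalent_asymptotically_disjoint (X : Type)
    (C C' : coarse_structure X) (x : X) (A B : set X) :
  lambda_equivalent C C' ->
  asymptotically_disjoint C A B <-> asymptotically_disjoint C' A B.
Proof.
move=> eqC; rewrite !asymptotically_disjoint_linked.
by rewrite !(bounded_linked0 _ x) eqC.
Qed.

Theorem corollary10 : lambda_stable (@normal_ballean).
Proof.
move=> X C C' eqC nC.
have [[x]|X0] := pselect (inhabited X); last first.
  by apply: normal_ballean_empty => x; apply: X0.
have eqdis := lambda_equivalent_asymptotically_disjoint x _ _ eqC.
(* The sets [U] and [V] found for [C] also serve for [C']. *)
move=> A B /eqdis/nC[U [V [nU nV UV0]]]; exists U, V; split=> //.
- by apply/asymptotic_neighbourhoodP/eqdis/asymptotic_neighbourhoodP.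
- by apply/asymptotic_neighbourhoodP/eqdis/asymptotic_neighbourhoodP.
Qed.
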